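(* Let $\mathcal B\subseteq\mathbb N$ be infinite, let $S_1\subset S_2\subset\dots$ be a filtration of $\mathcal B$ by finite sets, and let $s_k,c_k,d_k$ be the associated integers. Then: a) $0\to H_{\operatorname{int}(W)}\to H\cong\varprojlim\mathbb Z/s_k\mathbb Z\to\varprojlim\mathbb Z/d_k\mathbb Z\to0$ is an exact sequence. b) $H_{\operatorname{int}(W)}\cong\varprojlim\mathbb Z/\tfrac{s_k}{d_k}\mathbb Z$. c) $H/H_{\operatorname{int}(W)}\cong\varprojlim\mathbb Z/d_k\mathbb Z$. d) $H_{\operatorname{int}(W)}=\{0\}$ if and only if $s_k=d_k$ for each $k\in\mathbb N$, equivalently if for each $b\in\mathcal B$ there is $n>0$ such that $b$ divides $c_n$.
   Context: $\mathbb N=\{1,2,\dots\}$. For $A\subseteq\mathbb N$ let $\mathcal M_A=\bigcup_{a\in A}a\mathbb Z$. $\Delta:\mathbb Z\to\prod_{b\in\mathcal B}\mathbb Z/b\mathbb Z$, $\Delta(n)=(n \bmod b)_{b\in\mathcal B}$; $H:=\overline{\Delta(\mathbb Z)}$ is a compact abelian group (product topology); the window is $W:=\{h\in H: h_b\neq 0\ \forall b\in\mathcal B\}$; $\operatorname{int}(W)$ is its interior in $H$. For $A\subseteq H$, $H_A:=\{h\in H:A+h=A\}$ is the period group of $A$. For finite $S\subset\mathcal B$: $\mathcal A_S:=\{\gcd(b,\operatorname{lcm}(S)):b\in\mathcal B\}$ (a finite set). A filtration of $\mathcal B$ by finite sets is an increasing sequence of finite subsets with union $\mathcal B$. Put $s_k:=\operatorname{lcm}(S_k)$;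 $c_l$ := minimal period of $\mathcal M_{\mathcal A_{S_l}}$, i.e. the least $c\in\mathbb N$ with $c+\mathcal M_{\mathcal A_{S_l}}=\mathcal M_{\mathcal A_{S_l}}$; one has $c_l\mid c_{l+1}$, so for each $k$ the sequence $(\gcd(s_k,c_{k+j}))_{j}$ is eventually constant, and $d_k:=\lim_{j\to\infty}\gcd(s_k,c_{k+j})$. Then $s_k\mid s_{k+1}$, $d_k\mid d_{k+1}$, $d_k\mid s_k$ and $\frac{s_k}{d_k}\mid\frac{s_{k+1}}{d_{k+1}}$; all inverse limits are taken along the canonical projections. The isomorphism $\varprojlim\mathbb Z/s_k\mathbb Z\cong H$ sends $(n_k+s_k\mathbb Z)_k$ to the $h\in H$ with $h_b=n_k\bmod b$ for all $b\in S_k$, $k\in\mathbb N$. In a), the first map is the inclusion and the last nontrivial map is induced by the projections $\mathbb Z/s_k\mathbb Z\to\mathbb Z/d_k\mathbb Z$. *)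

(* Defs.v *)
From HB Require Import structures.
From mathcomp Require Import all_boot all_order all_algebra finmap.
From mathcomp Require Import all_classical topology tvs.

Set Implicit Arguments.
Unset Strict Implicit.
Unset Printing Implicit Defensive.

Import Order.TTheory GRing.Theory Num.Theory.
Local Open Scope classical_set_scope.
Local Open Scope ring_scope.

(* ['Z_n] is Z/2 for n = 1, hence ordinals: for 0 < n this is Z/n, trivial
   group included. *)
Definition Zmod (n : nat) : Type := discrete_topology 'I_n.-1.+1.

HB.instance Definition _ n := DiscreteTopology.copy (Zmod n) (discrete_topology 'I_n.-1.+1).
HB.instance Definition _ n := GRing.Zmodule.copy (Zmod n) 'I_n.-1.+1.

Lemma Zmod_sub_continuous n : continuous (fun x : Zmod n * Zmod n => x.1 - x.2).
Proof.
move=> [x y]; apply/discrete_cvg.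
exists ([set x], [set y]); first by split; exact: discrete_set1.
by move=> [a b] /= [-> ->].
Qed.

HB.instance Definition _ n :=
  PreTopologicalNmodule_isTopologicalZmodule.Build (Zmod n) (@Zmod_sub_continuous n).

Definition residue (n : nat) (z : int) : Zmod n := inZp `|(z %% n)%Z|%N.

(* The canonical projection Z/m -> Z/n; meaningful when n divides m. *)
Definition Zmod_proj (m n : nat) (x : Zmod m) : Zmod n := inZp (x : 'I_m.-1.+1).

Section Zprod.
Variables (I : eqType) (m : I -> nat).

Definition Zprod : Type := forall i, Zmod (m i).

HB.instance Definition _ := Topological.copy Zprod
  (prod_topology (fun i => Zmod (m i) : topologicalType)).

Implicit Types f g h : Zprod.
Let zero : Zprod := fun=> 0.
Let opp f : Zprod := fun i => - f i.
Let add f g : Zprod := fun i => f i + g i.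

Let addA : associative add.
Proof. by move=> f g h; apply/functional_extensionality_dep => i; exact: addrA. Qed.
Let addC : commutative add.
Proof. by move=> f g; apply/functional_extensionality_dep => i; exact: addrC. Qed.
Let add0 : left_id zero add.
Proof. by move=> f; apply/functional_extensionality_dep => i; exact: add0r. Qed.
Let addN : left_inverse zero opp add.
Proof. by move=> f; apply/functional_extensionality_dep => i; exact: addNr. Qed.

HB.instance Definition _ := GRing.isZmodule.Build Zprod addA addC add0 addN.

Lemma Zprod_cvg (F : set_system Zprod) (f : Zprod) : Filter F ->
  (forall i, (fun g : Zprod => g i) @ F --> f i) -> F --> f.
Proof.
move=> FF cF; apply/cvg_sup => i A.
rewrite nbhsE => -[U [[V oV <-] Vf] VA].
apply: (@filterS _ F FF _ _ VA); apply: (cF i); exact: open_nbhs_nbhs.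
Qed.

Lemma Zprod_proj_continuous i : continuous (fun f : Zprod => f i).
Proof. exact: (@proj_continuous I (fun i => Zmod (m i) : topologicalType) i). Qed.

Lemma Zprod_sub_continuous : continuous (fun x : Zprod * Zprod => x.1 - x.2).
Proof.
move=> x; apply: Zprod_cvg => i.
have c1 : (fun y : Zprod * Zprod => y.1 i) @ x --> x.1 i.
  apply: (@cvg_comp _ Zprod _ fst (fun f : Zprod => f i) _ (nbhs x.1)).
    exact: cvg_fst.
  exact: Zprod_proj_continuous.
have c2 : (fun y : Zprod * Zprod => y.2 i) @ x --> x.2 i.
  apply: (@cvg_comp _ Zprod _ snd (fun f : Zprod => f i) _ (nbhs x.2)).
    exact: cvg_snd.
  exact: Zprod_proj_continuous.
apply: (@cvg_comp _ _ _ _ (fun x : Zmod (m i) * Zmod (m i) => x.1 - x.2) _ _ _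
  (cvg_pair c1 c2)).
exact: (@sub_continuous (Zmod (m i)) (x.1 i, x.2 i)).
Qed.

HB.instance Definition _ :=
  PreTopologicalNmodule_isTopologicalZmodule.Build Zprod Zprod_sub_continuous.

End Zprod.

Section Subgroup.
Variables (G : topologicalZmodType) (S : zmodClosed G).

Definition subgroup : Type := {x : G | x \in S}.

HB.instance Definition _ := [isSub of subgroup for @sval G (fun x => x \in S)].
HB.instance Definition _ := [Choice of subgroup by <:].
HB.instance Definition _ := Topological.copy subgroup
  (initial_topology (val : subgroup -> G)).
HB.instance Definition _ := [SubChoice_isSubZmodule of subgroup by <:].

Lemma subgroup_val_continuous : continuous (val : subgroup -> G).
Proof. exact: initial_continuous. Qed.

Lemma subgroup_sub_continuous :
  continuous (fun x : subgroup * subgroup => x.1 - x.2).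
Proof.
apply/continuousP => _ [A oA <-].
have : continuous (fun x : subgroup * subgroup => val x.1 - val x.2).
  move=> x.
  have c1 : (fun y : subgroup * subgroup => val y.1) @ x --> val x.1.
    apply: (@cvg_comp _ subgroup _ fst val _ (nbhs x.1)).
      exact: cvg_fst.
    exact: subgroup_val_continuous.
  have c2 : (fun y : subgroup * subgroup => val y.2) @ x --> val x.2.
    apply: (@cvg_comp _ subgroup _ snd val _ (nbhs x.2)).
      exact: cvg_snd.
    exact: subgroup_val_continuous.
  apply: (@cvg_comp _ _ _ _ (fun x : G * G => x.1 - x.2) _ _ _ (cvg_pair c1 c2)).
  exact: (@sub_continuous G (val x.1, val x.2)).
by move=> /continuousP /(_ _ oA); congr open; apply/seteqP; split => x /=; rewrite raddfB.
Qed.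

HB.instance Definition _ :=
  PreTopologicalNmodule_isTopologicalZmodule.Build subgroup subgroup_sub_continuous.

Definition quotient_group : Type := quotient_topology (Quotient.quot S).

HB.instance Definition _ := Topological.copy quotient_group
  (quotient_topology (Quotient.quot S)).
HB.instance Definition _ := GRing.isZmodule.Build quotient_group
  (@Quotient.addqA G S) (@Quotient.addqC G S) (@Quotient.add0q G S)
  (@Quotient.addNq G S).

Lemma quotient_sub_continuous :
  continuous (fun x : quotient_group * quotient_group => x.1 - x.2).
Proof.
pose p : G -> quotient_group := \pi_(Quotient.quot S)%qT.
have pB x y : p (x - y) = p x - p y by rewrite /p; exact: pi_is_zmod_morphism.
have pP x y : reflect (p x = p y) (x - y \in S).
  by rewrite Quotient.idealrBE; exact: (iffP eqP).
have pc : continuous p by exact: (@pi_continuous G (Quotient.quot S)).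
have p_open (A : set G) : open A -> open (p @` A).
  move=> oA; rewrite /open /= /quotient_open.
  have -> : \pi_(quotient_topology (Quotient.quot S))%qT @^-1` (p @` A)
      = \bigcup_(s in [set s | s \in S]) ((fun x => x - s) @^-1` A).
    apply/seteqP; split => [x [a Aa /pP aS]|x [s Ss As]].
      exists (x - a); first by rewrite /= -opprB rpredN.
      by rewrite /= opprB addrCA subrr addr0.
    exists (x - s) => //; apply/pP.
    by rewrite addrAC subrr add0r rpredN.
  apply: bigcup_open => s _.
  apply: open_comp => // x _.
  apply: (@cvg_comp _ _ _ (fun x : G => (x, s)) (fun z : G * G => z.1 - z.2) _ _ _
    (cvg_pair cvg_id (cvg_cst s))).
  exact: (@sub_continuous G (x, s)).
move=> [x y] U /=.
rewrite -[x]reprK -[y]reprK; set a := repr x; set b := repr y.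
rewrite -pB => nU.
have : nbhs (a, b) [set z : G * G | U (p z.1 - p z.2)].
  have : (fun z : G * G => p (z.1 - z.2)) @ (a, b) --> p (a - b).
    apply: (@cvg_comp _ _ _ (fun z : G * G => z.1 - z.2) p _ (nbhs (a - b))).
      exact: (@sub_continuous G (a, b)).
    exact: pc.
  by move=> /(_ _ nU) nU2; apply: (@filterS _ (nbhs (a, b)) _ _ _ _ nU2) => z /=; rewrite pB.
case=> -[A B] [/= nA nB] AB.
exists (p @` A, p @` B) => /=.
  move: nA nB; rewrite !nbhsE => -[A' [oA' A'a] A'A] [B' [oB' B'b] B'B].
  split.
    exists (p @` A'); last exact: image_subset.
    by split; [exact: p_open|exists a].
  exists (p @` B'); last exact: image_subset.
  by split; [exact: p_open|exists b].
by move=> [_ _] [/= [u Au <-] [v Bv <-]]; exact: (AB (u, v)).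
Qed.

HB.instance Definition _ :=
  PreTopologicalNmodule_isTopologicalZmodule.Build quotient_group
    quotient_sub_continuous.

End Subgroup.

Definition is_topgrp_iso (G K : topologicalZmodType)
    (f : {additive G -> K}) (g : {additive K -> G}) : Prop :=
  [/\ continuous f, continuous g, cancel f g & cancel g f].

Definition topgrp_iso (G K : topologicalZmodType) : Prop :=
  exists (f : {additive G -> K}) (g : {additive K -> G}), is_topgrp_iso f g.

Definition short_exact (G1 G2 G3 : topologicalZmodType)
    (f : {additive G1 -> G2}) (g : {additive G2 -> G3}) : Prop :=
  [/\ continuous f /\ continuous g, injective f,
      range f = [set x | g x = 0] & range g = setT].

Section PeriodGroup.
Variables (G : zmodType) (A : set G).

Definition period_group : {pred G} := fun h => `[< [set a + h | a in A] = A >].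

Lemma period_group_zmod_closed : zmod_closed period_group.
Proof.
have addE (h k : G) : [set a + (h + k) | a in A] = [set a + k | a in [set a + h | a in A]].
  apply/seteqP; split => [_ [a Aa <-]|_ [_ [a Aa <-] <-]].
    by rewrite addrA; exists (a + h) => //; exists a.
  by exists a => //; rewrite addrA.
have add0 : [set a + 0 | a in A] = A.
  by apply/seteqP; split => [_ [a Aa <-]|a Aa]; [rewrite addr0|exists a => //; rewrite addr0].
split=> [|h k /asboolP hA /asboolP kA]; apply/asboolP => //.
by rewrite addE hA -[in LHS]kA -addE subrr add0.
Qed.

HB.instance Definition _ :=
  GRing.isZmodClosed.Build G period_group period_group_zmod_closed.

End PeriodGroup.

Section ResidueTheory.

Lemma Zmod_addE n (x y : Zmod n) :
  val (x + y : 'I_n.-1.+1) = ((val (x : 'I_n.-1.+1) + val (y : 'I_n.-1.+1)) %% n.-1.+1)%N.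
Proof. by []. Qed.

Lemma zmod_morphism_of_add (U V : zmodType) (f : U -> V) :
  {morph f : x y / x + y} -> zmod_morphism f.
Proof. by move=> fD x y; apply: (addIr (f y)); rewrite -fD !subrK. Qed.

Lemma residueE n z : (0 < n)%N -> (val (residue n z : 'I_n.-1.+1))%:Z = (z %% n)%Z.
Proof.
move=> n0; have nz : n%:Z != 0 by rewrite eqz_nat -lt0n.
rewrite /= (prednK n0).
have -> : (`|(z %% n)%Z| %% n)%N = `|(z %% n)%Z|%N.
  apply: modn_small; rewrite -ltz_nat gez0_abs ?modz_ge0//.
  by have := ltz_mod z nz; rewrite /= .
by rewrite gez0_abs // modz_ge0.
Qed.

Lemma residue_is_zmod_morphism n : zmod_morphism (residue n).
Proof.
apply: zmod_morphism_of_add => x y; case: (posnP n) => [->|n0].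
  by rewrite [LHS](@ord1 (residue 0 (x + y))) [RHS]ord1.
apply/val_inj/eqP; rewrite -eqz_nat (residueE _ n0) (Zmod_addE (residue n x)).
by rewrite -modz_nat PoszD !residueE // (prednK n0) modzDml modzDmr.
Qed.

HB.instance Definition _ n :=
  GRing.isZmodMorphism.Build int (Zmod n) (residue n) (@residue_is_zmod_morphism n).

Lemma Zmod_proj_is_zmod_morphism m n : (0 < m)%N -> (n %| m)%N ->
  zmod_morphism (@Zmod_proj m n).
Proof.
move=> m0 nm; have n0 : (0 < n)%N by exact: dvdn_gt0 nm.
have nm' : (n.-1.+1 %| m.-1.+1)%N by rewrite !prednK.
apply: zmod_morphism_of_add => x y; apply/val_inj => /=.
by rewrite modn_dvdm // modnDm.
Qed.

End ResidueTheory.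

Section InverseLimit.

Definition divchain (m : nat -> nat) : Prop :=
  forall k, (0 < m k)%N /\ (m k %| m k.+1)%N.

Variables (m : nat -> nat) (hm : divchain m).

Definition invlim_pred of divchain m : {pred Zprod m} :=
  fun x => `[< forall k, Zmod_proj (m k) (x k.+1) = x k >].

Lemma invlim_zmod_closed : zmod_closed (invlim_pred hm).
Proof.
have pB k : zmod_morphism (@Zmod_proj (m k.+1) (m k)).
  by apply: Zmod_proj_is_zmod_morphism; [exact: (hm k.+1).1|exact: (hm k).2].
split=> [|x y /asboolP hx /asboolP hy]; apply/asboolP => k.
  by rewrite -[X in Zmod_proj _ X](subrr 0) pB subrr.
by rewrite -[RHS]/(x k - y k) -(hx k) -(hy k) -pB.
Qed.

HB.instance Definition _ :=
  GRing.isZmodClosed.Build (Zprod m) (invlim_pred hm) invlim_zmod_closed.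

Definition invlim : Type := subgroup (invlim_pred hm).
HB.instance Definition _ := TopologicalZmodule.on invlim.

End InverseLimit.

Section InverseLimitMap.
Variables (m m' : nat -> nat) (hm : divchain m) (hm' : divchain m').
Hypothesis hd : forall k, (m' k %| m k)%N.

Lemma invlim_map_subproof (x : invlim hm) :
  (fun k => Zmod_proj (m' k) (val x k) : Zmod (m' k)) \in invlim_pred hm'.
Proof.
case: x => x /= /asboolP hx; apply/asboolP => k; rewrite -(hx k).
apply/val_inj => /=.
have dvd1 : ((m' k).-1.+1 %| (m k).-1.+1)%N.
  by rewrite !prednK ?(hm k).1 ?(hm' k).1.
have dvd2 : ((m' k).-1.+1 %| (m' k.+1).-1.+1)%N.
  by rewrite !prednK ?(hm' k).1 ?(hm' k.+1).1 ?(hm' k).2.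
by rewrite !modn_dvdm.
Qed.

Definition invlim_map (x : invlim hm) : invlim hm' :=
  exist _ (fun k => Zmod_proj (m' k) (val x k)) (invlim_map_subproof x).

Lemma invlim_map_is_zmod_morphism : zmod_morphism invlim_map.
Proof.
move=> x y; apply/val_inj/functional_extensionality_dep => k.
exact: (Zmod_proj_is_zmod_morphism (hm k).1 (hd k)).
Qed.

HB.instance Definition _ := GRing.isZmodMorphism.Build (invlim hm) (invlim hm')
  invlim_map invlim_map_is_zmod_morphism.

End InverseLimitMap.

Arguments invlim_map {m m'} hm hm' hd x.

Section Window.
Variable B : set nat.

Definition Delta (n : int) : Zprod (fun b : B => \val b) :=
  fun b => residue (\val b) n.

Definition H_pred : {pred Zprod (fun b : B => \val b)} :=
  fun h => h \in closure (range Delta).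

Lemma H_zmod_closed : zmod_closed H_pred.
Proof.
have DB : zmod_morphism Delta.
  move=> x y; apply/functional_extensionality_dep => b; exact: raddfB.
split=> [|x y /set_mem xH /set_mem yH]; apply/mem_set.
  by apply: subset_closure; exists 0 => //; rewrite -(subrr 0) DB subrr.
move=> U /(@sub_continuous _ (x, y)) [[V1 V2] [/= V1x V2y] VU].
have [_ [[a _ <-] V1a]] := xH _ V1x.
have [_ [[b _ <-] V2b]] := yH _ V2y.
exists (Delta (a - b)); split; first by exists (a - b).
by rewrite DB; exact: (VU (Delta a, Delta b)).
Qed.

HB.instance Definition _ := GRing.isZmodClosed.Build _ H_pred H_zmod_closed.

Definition Hgroup : Type := subgroup H_pred.
HB.instance Definition _ := TopologicalZmodule.on Hgroup.

Definition window : set Hgroup := [set h | forall b : B, val h b != 0].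

Definition H_int_W : zmodClosed Hgroup := period_group (interior window).

End Window.

Section Periods.

Definition multiples (A : set nat) : set int :=
  \bigcup_(a in A) [set a%:Z * z | z in setT].

Definition is_period (M : set int) (c : nat) : Prop :=
  (0 < c)%N /\ [set c%:Z + x | x in M] = M.

(* The default value 0 is only reached when M has no period. *)
Definition min_period (M : set int) : nat :=
  xget 0%N [set c | is_period M c /\ forall c', is_period M c' -> (c <= c')%N].

Implicit Types (M : set int) (c : nat).

Lemma is_periodP M c :
  is_period M c <-> (0 < c)%N /\ forall x, M (x + c%:Z) <-> M x.
Proof.
split=> -[c0 cM]; split=> //.
  move=> x; split.
    by rewrite -{1}cM => -[y My]; rewrite addrC => /addIr <-.
  by move=> Mx; rewrite -cM; exists x => //; rewrite addrC.
apply/seteqP; split => [_ [x Mx <-]|x Mx]; first by rewrite addrC; apply/cM.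
by exists (x - c%:Z); [apply/cM; rewrite subrK|rewrite addrC subrK].
Qed.

Lemma min_periodP M c : is_period M c ->
  is_period M (min_period M) /\
  forall c', is_period M c' -> (min_period M <= c')%N.
Proof.
move=> Mc; rewrite /min_period; case: xgetP => [y _ //|].
have ex : exists c, `[< is_period M c >] by exists c; apply/asboolP.
case: (ex_minnP ex) => n /asboolP Mn nmin /(_ n) [].
by split=> // c' Mc'; apply: nmin; apply/asboolP.
Qed.

Lemma min_period_dvd M c : is_period M c -> (min_period M %| c)%N.
Proof.
move=> Mc; have [/is_periodP [p0 pM] pmin] := min_periodP Mc.
move: Mc => /is_periodP [c0 cM]; set p := min_period M in p0 pM pmin *.
have pMn k x : M (x + (k * p)%N%:Z) <-> M x.
  elim: k x => [|k IH] x; first by rewrite mul0n addr0.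
  by rewrite mulSn PoszD addrA IH pM.
rewrite /dvdn -leqn0 leqNgt; apply/negP => r0.
have : is_period M (c %% p)%N.
  apply/is_periodP; split=> // x.
  by rewrite -(pMn (c %/ p)%N) -addrA -PoszD addnC -divn_eq cM.
by move=> /pmin; rewrite leqNgt ltn_mod p0.
Qed.

Definition lcm_fset (S : {fset nat}) : nat := \big[lcmn/1%N]_(b <- S) b.

Definition gcd_set (B : set nat) (S : {fset nat}) : set nat :=
  [set gcdn b (lcm_fset S) | b in B].

Lemma multiplesE B S x : multiples (gcd_set B S) x <->
  exists2 b, B b & ((gcdn b (lcm_fset S))%:Z %| x)%Z.
Proof.
split=> [[_ [b Bb <-] [z _ <-]]|[b Bb /dvdzP [z ->]]].
  by exists b => //; exact: dvdz_mulr.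
by exists (gcdn b (lcm_fset S)); [exists b|exists z => //; rewrite mulrC].
Qed.

Lemma lcm_is_period B S : (0 < lcm_fset S)%N ->
  is_period (multiples (gcd_set B S)) (lcm_fset S).
Proof.
move=> s0; apply/is_periodP; split=> // x; rewrite !multiplesE.
by split=> -[b Bb h]; exists b => //; move: h; rewrite rpredDr // dvdzE dvdn_gcdr.
Qed.

Lemma is_period_sub B (S S' : {fset nat}) c :
  (lcm_fset S %| lcm_fset S')%N ->
  is_period (multiples (gcd_set B S')) c -> is_period (multiples (gcd_set B S)) c.
Proof.
move=> sS /is_periodP [c0 cM]; apply/is_periodP; split=> // x.
have gS b : (gcdn (gcdn b (lcm_fset S')) (lcm_fset S) = gcdn b (lcm_fset S))%N.
  by rewrite -gcdnA (gcdn_idPr sS).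
have lift y : multiples (gcd_set B S) y ->
    exists2 y', multiples (gcd_set B S') y' & ((lcm_fset S)%:Z %| y - y')%Z.
  move=> /multiplesE [b Bb /dvdzP [k ->]].
  have [u [v uv]] := Bezoutz (gcdn b (lcm_fset S'))%:Z (lcm_fset S)%:Z.
  exists (k * (u * (gcdn b (lcm_fset S'))%:Z)).
    by apply/multiplesE; exists b => //; rewrite mulrA dvdz_mull.
  rewrite -mulrBr -gS -[(gcdn _ _)%:Z]/(gcdz (gcdn b (lcm_fset S'))%:Z (lcm_fset S)%:Z).
  by rewrite -uv addrAC subrr add0r mulrA dvdz_mull.
have proj y y' : multiples (gcd_set B S') y' -> ((lcm_fset S)%:Z %| y - y')%Z ->
    multiples (gcd_set B S) y.
  move=> /multiplesE [b Bb by'] yy'; apply/multiplesE; exists b => //.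
  rewrite -(subrK y' y) rpredD //.
    by apply: dvdz_trans yy'; rewrite dvdzE dvdn_gcdr.
  by apply: dvdz_trans by'; rewrite dvdzE -gS dvdn_gcdl.
split=> /lift [y My dy].
  apply: (proj x (y - c%:Z)); first by apply/cM; rewrite subrK.
  by rewrite opprB addrA.
apply: (proj _ (y + c%:Z)); first exact/cM.
by rewrite opprD addrACA subrr addr0.
Qed.

End Periods.

Section Filtration.
Variables (B : set nat) (S : nat -> {fset nat}).

(* Indexed from 0; inclusions need not be strict. *)
Definition filtration : Prop :=
  (forall k, S k `<=` S k.+1)%fset /\ \bigcup_k [set` S k] = B.

Definition s_seq (k : nat) : nat := lcm_fset (S k).
Definition c_seq (l : nat) : nat := min_period (multiples (gcd_set B (S l))).
(* A limit in [nat], whose topology is discrete; see [d_eventually]. *)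
Definition d_seq (k : nat) : nat := lim (gcdn (s_seq k) (c_seq (k + j)%N) @[j --> \oo]).
Definition sd_seq (k : nat) : nat := (s_seq k %/ d_seq k)%N.

Hypothesis B_gt0 : B `<=` [set b | (0 < b)%N].
Hypothesis HS : filtration.

Lemma s_gt0 k : (0 < s_seq k)%N.
Proof.
rewrite /s_seq /lcm_fset big_seq.
apply: (big_ind (fun n => (0 < n)%N)) => //; first by move=> x y x0 y0; rewrite lcmn_gt0 x0.
by move=> b bS; apply: B_gt0; rewrite -HS.2; exists k.
Qed.

Lemma s_dvd k : (s_seq k %| s_seq k.+1)%N.
Proof.
rewrite /s_seq /lcm_fset [X in (X %| _)%N]big_seq.
apply: (big_ind (fun n => (n %| _)%N)); [exact: dvd1n|by move=> x y hx hy; rewrite dvdn_lcm hx|].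
move=> b /(fsubsetP (HS.1 k)) bS.
by rewrite (big_rem b) //= dvdn_lcml.
Qed.

Lemma c_is_period l : is_period (multiples (gcd_set B (S l))) (c_seq l).
Proof. by have [] := min_periodP (lcm_is_period B (s_gt0 l)). Qed.

Lemma c_dvd l : (c_seq l %| c_seq l.+1)%N.
Proof. exact/min_period_dvd/(is_period_sub (s_dvd l))/c_is_period. Qed.

Lemma c_dvd_le l l' : (l <= l')%N -> (c_seq l %| c_seq l')%N.
Proof.
move=> /subnKC <-; elim: (l' - l)%N => [|n IH]; first by rewrite addn0.
by rewrite addnS (dvdn_trans IH) // c_dvd.
Qed.

Lemma d_eventually k : exists N, forall n, (N <= n)%N -> d_seq k = gcdn (s_seq k) (c_seq n).
Proof.
pose f j := gcdn (s_seq k) (c_seq (k + j)%N).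
have ex : exists v, `[< exists j, f j = v >] by exists (f 0%N); apply/asboolP; exists 0%N.
have ub v : `[< exists j, f j = v >] -> (v <= s_seq k)%N.
  by move=> /asboolP [j <-]; rewrite dvdn_leq ?s_gt0 ?dvdn_gcdl.
case: (ex_maxnP ex ub) => v /asboolP [J fJ] vmax.
have fv j : (J <= j)%N -> f j = v.
  move=> Jj; apply/eqP; rewrite eqn_leq vmax /=; last by apply/asboolP; exists j.
  rewrite -fJ dvdn_leq ?gcdn_gt0 ?s_gt0 // dvdn_gcd dvdn_gcdl /=.
  by apply: (dvdn_trans (dvdn_gcdr _ _)); apply: c_dvd_le; rewrite leq_add2l.
have dv : d_seq k = v.
  apply: lim_near_cst; first exact: discrete_hausdorff.
  by exists J => // j /= /fv.
exists (k + J)%N => n kJn; rewrite dv -(fv (n - k)%N).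
  by rewrite /f subnKC // (leq_trans _ kJn) // leq_addr.
by rewrite leq_subRL // (leq_trans _ kJn) // leq_addr.
Qed.

Lemma d_dvd_s k : (d_seq k %| s_seq k)%N.
Proof. by have [N /(_ N (leqnn N)) ->] := d_eventually k; rewrite dvdn_gcdl. Qed.

Lemma d_gt0 k : (0 < d_seq k)%N.
Proof. exact: dvdn_gt0 (s_gt0 k) (d_dvd_s k). Qed.

Lemma s_chain : divchain s_seq.
Proof. by move=> k; split; [exact: s_gt0|exact: s_dvd]. Qed.

Lemma d_chain : divchain d_seq.
Proof.
move=> k; split; first exact: d_gt0.
have [[N hN] [N' hN']] := (d_eventually k, d_eventually k.+1).
rewrite (hN (maxn N N')) ?leq_maxl // (hN' (maxn N N')) ?leq_maxr //.
by rewrite dvdn_gcd dvdn_gcdr (dvdn_trans (dvdn_gcdl _ _)) ?s_dvd.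
Qed.

Lemma sd_chain : divchain sd_seq.
Proof.
move=> k; split; first by rewrite divn_gt0 ?d_gt0 // dvdn_leq ?s_gt0 ?d_dvd_s.
have [[N hN] [N' hN']] := (d_eventually k, d_eventually k.+1).
have dd := (d_chain k).2; have [d0 d0'] := (d_gt0 k, d_gt0 k.+1).
have cop : coprime (sd_seq k) (d_seq k.+1 %/ d_seq k).
  pose n := maxn N N'.
  have cE : d_seq k = gcdn (s_seq k) (c_seq n) by rewrite (hN n) ?leq_maxl.
  have dc : (d_seq k.+1 %| c_seq n)%N by rewrite (hN' n) ?leq_maxr // dvdn_gcdr.
  have dkc : (d_seq k %| c_seq n)%N by rewrite cE dvdn_gcdr.
  apply: (@coprime_dvdr _ (c_seq n %/ d_seq k)).
    by rewrite -(dvdn_pmul2r d0) !divnK.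
  by rewrite /coprime -(eqn_pmul2r d0) mul1n muln_gcdl !divnK ?d_dvd_s // -cE.
rewrite -(Gauss_dvdl _ cop) -(dvdn_pmul2r d0) /sd_seq.
by rewrite divnK ?d_dvd_s // -mulnA divnK // divnK ?d_dvd_s // s_dvd.
Qed.

End Filtration.

(* Main.v *)
(* Write h_k for an integer representing h in Z/s_k. An integer n lies outside
   M_k = M_{A_{S_k}} iff the cylinder {h : h_k = n} is contained in W, so int(W)
   is the set of h with h_k outside M_k for some k. Hence g is a period of
   int(W) iff each g_k is a period of M_k, iff c_k | g_k for all k, iff
   d_k | g_k for all k: thus H_{int(W)} is the kernel of H -> lim Z/d_k.

   As gcd(s_k, d_{k+1}) = d_k, the Chinese remainder theorem lifts a point of
   lim Z/d_k to lim Z/s_k level by level; this lift is continuous, which gives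
   surjectivity and the homeomorphism in c). For b), division by d_k is not
   compatible with the projections, since d_{k+1}/d_k is only a unit modulo
   s_k/d_k; instead one divides by a topological generator (g_k) of the kernel,
   that is, by a point of lim Z/s_k with gcd(g_k, s_k) = d_k for all k. *)
(* Write h_k for an integer representing h in Z/s_k. An integer n lies outside
   M_k = M_{A_{S_k}} iff the cylinder {h : h_k = n} is contained in W, so int(W)
   is the set of h with h_k outside M_k for some k. Hence g is a period of
   int(W) iff each g_k is a period of M_k, iff c_k | g_k for all k, iff
   d_k | g_k for all k: thus H_{int(W)} is the kernel of H -> lim Z/d_k.

   As gcd(s_k, d_{k+1}) = d_k, the Chinese remainder theorem lifts a point of
   lim Z/d_k to lim Z/s_k level by level; this lift is continuous, which gives
   surjectivity and the homeomorphism in c). For b), division by d_k is not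
   compatible with the projections, since d_{k+1}/d_k is only a unit modulo
   s_k/d_k; instead one divides by a topological generator (g_k) of the kernel,
   that is, by a point of lim Z/s_k with gcd(g_k, s_k) = d_k for all k. *)
Require Import Defs.
From HB Require Import structures.
From mathcomp Require Import all_boot all_order all_algebra finmap.
From mathcomp Require Import all_classical topology tvs.

Set Implicit Arguments.
Unset Strict Implicit.
Unset Printing Implicit Defensive.

Import Order.TTheory GRing.Theory Num.Theory.
Local Open Scope classical_set_scope.
Local Open Scope ring_scope.

(** * Residues and inverse limits *)

Definition rep n (x : Zmod n) : int := (x : 'I_n.-1.+1)%:Z.

Lemma residue_rep n (x : Zmod n) : residue n (rep x) = x.
Proof.
case: (posnP n) x => [->|n0] x; first by rewrite [LHS]ord1 [RHS]ord1.
apply/val_inj/eqP; rewrite -eqz_nat residueE // modz_nat modn_small //.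
by have := ltn_ord x; rewrite [X in (_ < X)%N]prednK.
Qed.

Lemma residue_eqP n (y z : int) : (0 < n)%N ->
  reflect (residue n y = residue n z) (n %| y - z)%Z.
Proof.
move=> n0; rewrite -eqz_mod_dvd; apply: (iffP eqP) => [yz|/(congr1 (@rep n))].
  by apply/val_inj/eqP; rewrite -eqz_nat !residueE // yz.
by rewrite /rep !residueE.
Qed.

Lemma residue0P n (z : int) : (0 < n)%N -> reflect (residue n z = 0) (n %| z)%Z.
Proof.
by move=> n0; rewrite -[z in (_ %| z)%Z]subr0 -(raddf0 (residue n)); exact: residue_eqP.
Qed.

Lemma dvdz_rep_residue n z : (0 < n)%N -> (n %| rep (residue n z) - z)%Z.
Proof. by move=> n0; apply/residue_eqP; rewrite ?residue_rep. Qed.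

Lemma Zmod_projE m n (x : Zmod m) : (0 < n)%N -> Zmod_proj n x = residue n (rep x).
Proof. by case: n => // n _; apply/val_inj; rewrite /= /rep modz_nat /= modn_mod. Qed.

Lemma residue_proj m n z : (0 < m)%N -> (n %| m)%N ->
  Zmod_proj n (residue m z) = residue n z.
Proof.
move=> m0 nm; have n0 : (0 < n)%N by exact: dvdn_gt0 nm.
rewrite Zmod_projE //; apply/residue_eqP => //.
by apply: (dvdz_trans (n:=m)); [rewrite dvdzE|exact: dvdz_rep_residue].
Qed.

Section CompatibleSequences.
Variables (m : nat -> nat) (hm : divchain m).
Implicit Types (n : nat -> int) (x : invlim hm).

Definition compatible n := forall k, (m k %| n k.+1 - n k)%Z.

Lemma compatible_le n j k : compatible n -> (j <= k)%N -> (m j %| n k - n j)%Z.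
Proof.
move=> cn /subnKC <-; elim: (k - j)%N => [|i IH]; first by rewrite addn0 subrr dvdz0.
rewrite addnS -(subrKA (n (j + i)%N)) rpredD //.
apply: dvdz_trans (cn _); rewrite dvdzE /=.
elim: i {IH} => [|i IH]; first by rewrite addn0.
by rewrite addnS (dvdn_trans IH) //; exact: (hm _).2.
Qed.

Lemma compatible_mem n : compatible n ->
  ((fun k => residue (m k) (n k)) : Zprod m) \in invlim_pred hm.
Proof.
move=> cn; apply/asboolP => k; rewrite residue_proj ?(hm _).1 ?(hm k).2 //.
by apply/residue_eqP; [exact: (hm k).1|].
Qed.

Definition invlim_of n (cn : compatible n) : invlim hm :=
  exist _ (fun k => residue (m k) (n k)) (compatible_mem cn).

Lemma rep_compatible x : compatible (fun k => rep (val x k)).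
Proof.
move=> k; apply/residue_eqP; first exact: (hm k).1.
rewrite residue_rep -(asboolP _ (valP x) k) -{2}(residue_rep (val x k.+1)).
by rewrite residue_proj ?(hm _).1 ?(hm k).2.
Qed.

Lemma invlim_ext x y : (forall k, val x k = val y k) -> x = y.
Proof. by move=> xy; apply/val_inj/functional_extensionality_dep. Qed.

End CompatibleSequences.

(** Coordinates are discrete, so continuity into the limit is local constancy of each coordinate. *)
Lemma continuous_invlim (X : topologicalType) (m : nat -> nat) (hm : divchain m)
    (f : X -> invlim hm) :
  (forall k x, \forall y \near x, val (f y) k = val (f x) k) -> continuous f.
Proof.
move=> cf; apply: continuous_comp_initial => x; apply: Zprod_cvg => k.
exact/discrete_cvg/cf.
Qed.

Lemma near_Zprod (I : eqType) (m : I -> nat) (f : Zprod m) i :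
  nbhs f [set g : Zprod m | g i = f i].
Proof. exact: (Zprod_proj_continuous (discrete_set1 (f i))). Qed.

Lemma near_invlim (m : nat -> nat) (hm : divchain m) k (x : invlim hm) :
  \forall y \near x, val y k = val x k.
Proof. exact: (subgroup_val_continuous (near_Zprod (val x) k)). Qed.

(** The inverse of an additive bijection is additive, so [g] may be given as a bare function. *)
Lemma topgrp_iso_of_cancel (G K : topologicalZmodType) (f : {additive G -> K}) (g : K -> G) :
  continuous f -> continuous g -> cancel f g -> cancel g f ->
  exists g' : {additive K -> G}, [/\ g' =1 g & is_topgrp_iso f g'].
Proof.
move=> cf cg fK gK.
have gB : zmod_morphism g by move=> x y; rewrite -{1}[x]gK -{1}[y]gK -raddfB fK.
pose gM := GRing.isZmodMorphism.Build K G g gB.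
pose g' : {additive K -> G} := HB.pack g gM.
by exists g'; split.
Qed.

(** * Cylinders and the interior of the window *)

Section Cylinders.
Variables (B : set nat) (S : nat -> {fset nat}).
Hypothesis B_gt0 : B `<=` [set b | (0 < b)%N].
Hypothesis HS : filtration B S.
Implicit Types (h g : Hgroup B) (b : B).

Lemma B_val_gt0 b : (0 < \val b)%N.
Proof. exact/B_gt0/set_mem/valP. Qed.

Lemma filtration_le j k : (j <= k)%N -> (S j `<=` S k)%fset.
Proof.
move=> /subnKC <-; elim: (k - j)%N => [|i IH]; first by rewrite addn0.
by rewrite addnS (fsubset_trans IH) //; exact: HS.1.
Qed.

Lemma filtration_mem b : exists k, \val b \in S k.
Proof. by have := set_mem (valP b); rewrite -{1}HS.2 => -[k _ ?]; exists k. Qed.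

Definition cylinder (k : nat) (n : int) : set (Hgroup B) :=
  [set h | forall b, \val b \in S k -> val h b = residue (\val b) n].

Lemma Delta_mem n : Delta n \in @H_pred B.
Proof. by apply/mem_set; apply: subset_closure; exists n. Qed.

Definition DeltaH n : Hgroup B := exist _ (Delta n) (Delta_mem n).

Lemma DeltaH_cylinder k n : cylinder k n (DeltaH n).
Proof. by []. Qed.

Lemma lcm_fset_dvdz (T : {fset nat}) (z : int) :
  (forall b : nat, b \in T -> (b %| z)%Z) -> (lcm_fset T %| z)%Z.
Proof.
move=> Tz; rewrite /lcm_fset dvdzE /= big_seq.
by apply: (big_ind (fun n => (n %| _)%N)) => // x y hx hy; rewrite dvdn_lcm hx.
Qed.

Lemma dvdn_lcm_fset (T : {fset nat}) (b : nat) : b \in T -> (b %| lcm_fset T)%N.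
Proof. by move=> bT; rewrite /lcm_fset (big_rem b) //= dvdn_lcml. Qed.

Lemma cylinder_congr k n n' h : cylinder k n h ->
  cylinder k n' h <-> (s_seq S k %| n' - n)%Z.
Proof.
move=> hn; split => [hn'|nn' b bS].
  apply: lcm_fset_dvdz => b bS.
  have Bb : b \in B by apply/mem_set; rewrite -HS.2; exists k.
  have b0 := B_gt0 (set_mem Bb).
  by apply/residue_eqP => //; rewrite -(hn' (SigSub Bb)) // -(hn (SigSub Bb)).
rewrite (hn b bS); apply/esym/residue_eqP; first exact: B_val_gt0.
by apply: dvdz_trans nn'; rewrite dvdzE dvdn_lcm_fset.
Qed.

Lemma cylinder_le j k n : (j <= k)%N -> cylinder k n `<=` cylinder j n.
Proof. by move=> /filtration_le/fsubsetP jk h hn b /jk; exact: hn. Qed.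

Let near_coords (f : Zprod (fun b : B => \val b)) k :
  nbhs f [set g : Zprod (fun b : B => \val b) |
     forall b, \val b \in S k -> g b = f b].
Proof.
(* Indexing by naturals gives a finite intersection over [S k]; [P b] is everything when [b] is
   outside [B]. *)
pose P (b : nat) := [set g : Zprod (fun b : B => \val b) |
  forall b' : B, \val b' = b -> g b' = f b'].
have /(@filter_bigI _ _ (S k) P _ _) : forall b : nat, b \in S k -> nbhs f (P b).
  move=> b _; have [Bb|nBb] := pselect (B b).
    apply: filterS (near_Zprod f (SigSub (mem_set Bb))) => g gb b' b'b.
    by have <- : SigSub (mem_set Bb) = b' by apply/val_inj.
  by apply: filterE => g b' b'b; case: nBb; rewrite -b'b; exact/set_mem/valP.
by apply: filterS => g gP b bS; exact: (gP (\val b)).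
Qed.

(** The image of [Delta] is dense in [H], so it meets the neighbourhood fixing the coordinates in
    [S k]. *)
Lemma cylinder_exists k h : exists n, cylinder k n h.
Proof.
have [_ [[n _ <-] nh]] := set_mem (valP h) _ (near_coords (val h) k).
by exists n => b bS; rewrite -nh.
Qed.

(** An integer for the class of [h] in Z/s_k, canonical only modulo s_k; by [cylinder_exists] the
    default 0 of [xget] is never reached. *)
Definition int_lift k h : int := xget 0 [set n | cylinder k n h].

Lemma liftP k h : cylinder k (int_lift k h) h.
Proof.
rewrite /int_lift; case: xgetP => [n -> //|none].
by have [n hn] := cylinder_exists k h; case: (none n).
Qed.

Lemma cylinder_nbhs k n h : cylinder k n h -> nbhs h (cylinder k n).
Proof.
move=> hn; have : nbhs h [set g | forall b, \val b \in S k -> val g b = val h b].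
  exact: (subgroup_val_continuous (near_coords (val h) k)).
by apply: filterS => g gh b bS; rewrite gh // hn.
Qed.

(* The cylinders of [h] generate a filter that converges to [h] coordinatewise. *)
Lemma nbhs_cylinder h (U : set (Hgroup B)) : nbhs h U ->
  exists k, cylinder k (int_lift k h) `<=` U.
Proof.
move=> [_ /= [[V oV <-] Vh] VU].
pose D := fun k => [set f : Zprod (fun b : B => \val b) |
   forall b, \val b \in S k -> f b = val h b].
have FF : Filter (filter_from setT D).
  apply: filter_from_filter; first by exists 0%N.
  move=> i j _ _; exists (maxn i j) => // f fD.
  by split=> b bS; apply: fD; move: b bS => b; apply/fsubsetP/filtration_le;
    rewrite ?leq_maxl ?leq_maxr.
have : filter_from setT D --> val h.
  apply: Zprod_cvg => b; apply/discrete_cvg.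
  by have [k bk] := filtration_mem b; exists k => // f; exact.
move=> /(_ _ (open_nbhs_nbhs (conj oV Vh)))[k _ DV]; exists k => g gk.
apply: VU; apply: DV => b bS /=.
by rewrite gk // -(liftP h).
Qed.

Lemma liftD k g h : (s_seq S k %| int_lift k (g + h) - (int_lift k g + int_lift k h))%Z.
Proof.
have gh : cylinder k (int_lift k g + int_lift k h) (g + h).
  by move=> b bS; rewrite [RHS]raddfD /= -(liftP g) // -(liftP h).
exact: (cylinder_congr _ gh).1 (liftP _).
Qed.

Lemma lift_le j k h : (j <= k)%N -> (s_seq S j %| int_lift k h - int_lift j h)%Z.
Proof.
move=> jk; apply: (cylinder_congr _ (liftP h)).1.
exact: cylinder_le jk _ (liftP h).
Qed.

Local Notation M k := (multiples (gcd_set B (S k))).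

Lemma cylinder_window k n : cylinder k n `<=` window (B:=B) <-> ~ M k n.
Proof.
split=> [kW /multiplesE[b Bb gn]|nM h hn b].
  have [u [v uv]] := Bezoutz b%:Z (s_seq S k)%:Z.
  move/dvdzP: gn => [q nq].
  (* Here z = q u b is a multiple of [b] congruent to [n] modulo s_k, so [DeltaH z] is in the
     cylinder but not in the window. *)
  pose z := n - q * v * (s_seq S k)%:Z.
  have zb : (b %| z)%Z.
    rewrite /z nq -[(gcdn _ _)%:Z]/(gcdz b%:Z (s_seq S k)%:Z) -uv.
    by rewrite mulrDr !mulrA addrK dvdz_mull.
  have zW : window (DeltaH z).
    apply: kW; apply: (cylinder_congr _ (@DeltaH_cylinder k z)).2.
    by rewrite opprB addrC subrK dvdz_mull.
  have := zW (SigSub (mem_set Bb)) => /eqP; apply.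
  by apply/residue0P => //; exact: B_gt0.
apply/eqP => hb0; apply: nM; apply/multiplesE; exists (\val b); first exact/set_mem/valP.
(* At level [maxn k l] the integer lift of [h] is divisible by [b] and congruent to [n] modulo s_k,
   so gcd(b, s_k) divides [n]. *)
have [l bl] := filtration_mem b.
have : (\val b %| int_lift (maxn k l) h)%Z.
  apply/residue0P; first exact: B_val_gt0.
  rewrite -(liftP h) //; move: bl; apply/fsubsetP/filtration_le; exact: leq_maxr.
have := lift_le h (leq_maxl k l).
have := (cylinder_congr _ hn).1 (liftP h).
set x := int_lift k h; set y := int_lift _ h => xn yx yb.
have -> : n = y - (y - x) - (x - n) by rewrite subKr subKr.
have gb : (gcdn (\val b) (s_seq S k) %| (\val b)%:Z)%Z by rewrite dvdzE dvdn_gcdl.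
have gs : (gcdn (\val b) (s_seq S k) %| (s_seq S k)%:Z)%Z by rewrite dvdzE dvdn_gcdr.
apply: rpredB; last exact: dvdz_trans gs xn.
by apply: rpredB; [exact: dvdz_trans gb yb|exact: dvdz_trans gs yx].
Qed.

Lemma interior_windowP h : interior (window (B:=B)) h <-> exists k, ~ M k (int_lift k h).
Proof.
split=> [/nbhs_cylinder[k /cylinder_window ?]|[k /cylinder_window kW]].
  by exists k.
exact: filterS kW (cylinder_nbhs (liftP h)).
Qed.

End Cylinders.

(** * Periods *)

Lemma is_period_dvdz (M : set int) c (z : int) : is_period M c -> (c %| z)%Z ->
  forall x, M (x + z) <-> M x.
Proof.
move=> /is_periodP[_ cM] /dvdzP[q ->].
have shift n x : M (x + n%:Z * c%:Z) <-> M x.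
  elim: n x => [|n IH] x; first by rewrite mul0r addr0.
  by rewrite intS mulrDl mul1r addrA IH cM.
case: q => n x; first exact: shift.
by rewrite NegzE mulNr -(shift n.+1) subrK.
Qed.

Lemma min_period_dvdz (M : set int) (z : int) : (exists c, is_period M c) ->
  (forall x, M (x + z) <-> M x) -> (min_period M %| z)%Z.
Proof.
move=> [c Mc] zM; have [->|z0] := eqVneq z 0; first exact: dvdz0.
rewrite dvdzE; apply: min_period_dvd; apply/is_periodP; split; first by rewrite absz_gt0.
move=> x; case: (ltP 0 z) => [z_gt0|z_le0]; first by rewrite gtz0_abs.
by rewrite lez0_abs // -zM subrK.
Qed.

Lemma period_groupP (G : zmodType) (A : set G) g :
  g \in period_group A <-> forall h, A (h + g) <-> A h.
Proof.
split=> [/asboolP gA h|gA].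
  by split=> [|Ah]; [rewrite -{1}gA => -[a Aa /addIr <-]|rewrite -gA; exists h].
apply/asboolP/seteqP; split=> [_ [a Aa <-]|a Aa]; first exact/gA.
by exists (a - g); [apply/gA|]; rewrite subrK.
Qed.

Section PeriodsOfTheWindow.
Variables (B : set nat) (S : nat -> {fset nat}).
Hypothesis B_gt0 : B `<=` [set b | (0 < b)%N].
Hypothesis HS : filtration B S.

Local Notation M k := (multiples (gcd_set B (S k))).
Local Notation s := (s_seq S).
Local Notation c := (c_seq B S).
Local Notation d := (d_seq B S).
Local Notation lift := (@int_lift B S).
Local Notation cyl := (@cylinder B S).

Lemma s_dvd_le j k : (j <= k)%N -> (s j %| s k)%N.
Proof.
move=> /subnKC <-; elim: (k - j)%N => [|i IH]; first by rewrite addn0.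
by rewrite addnS (dvdn_trans IH) // (s_dvd HS).
Qed.

Lemma d_stable k : exists N, forall n, (N <= n)%N -> (k <= n)%N /\ d k = gcdn (s k) (c n).
Proof.
have [N hN] := d_eventually B_gt0 HS k.
exists (maxn k N) => n; rewrite geq_max => /andP[kn Nn]; split=> //; exact: hN.
Qed.

Lemma c_dvd_d k : (c k %| d k)%N.
Proof.
have [N /(_ N (leqnn N)) [kN ->]] := d_stable k.
rewrite dvdn_gcd (c_dvd_le B_gt0 HS kN) andbT.
exact: min_period_dvd (lcm_is_period B (s_gt0 B_gt0 HS k)).
Qed.

(** Both sides are gcd(s_j, c_n) for large n. The case k = j + 1 makes the Chinese remainder steps
    solvable. *)
Lemma gcdn_s_d j k : (j <= k)%N -> gcdn (s j) (d k) = d j.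
Proof.
move=> jk; have [[N hN] [N' hN']] := (d_stable j, d_stable k).
rewrite (hN (maxn N N') (leq_maxl _ _)).2 (hN' (maxn N N') (leq_maxr _ _)).2.
by rewrite gcdnA (gcdn_idPl (s_dvd_le jk)).
Qed.

Lemma H_int_WP (g : Hgroup B) :
  g \in H_int_W B <-> forall k, (d k %| lift k g)%Z.
Proof.
have cP := c_is_period B_gt0 HS.
split=> [/period_groupP gW|dg].
  (* Translation by [g] preserves int(W), and cylinders inside the window detect the complement of
     M_k, so [lift k g] is a period of M_k. *)
  have cg k : (c k %| lift k g)%Z.
    apply: min_period_dvdz => [|x]; first by exists (c k); exact: cP.
    have intW n : ~ M k n -> cyl k n `<=` interior (window (B:=B)) .
      move=> /(cylinder_window B_gt0 HS) nW h hn; exact: filterS nW (cylinder_nbhs hn).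
    split; apply: contraPP => nM; apply/(cylinder_window B_gt0 HS) => h hx;
        apply: nbhs_singleton.
      rewrite -(subrK g h); apply/gW/(intW _ nM) => b bS.
      by rewrite -[LHS]/(val h b - val g b) hx // (liftP g bS) -raddfB addrK.
    apply/gW; apply: (intW _ nM) => b bS.
    by rewrite -[LHS]/(val h b + val g b) hx // (liftP g bS) -raddfD.
  (* For large N, d_k = gcd(s_k, c_N), while c_N divides g_N and s_k divides g_N - g_k. *)
  move=> k; have [N /(_ N (leqnn N)) [kN ->]] := d_stable k.
  rewrite -[lift k g](subKr (lift N g)); apply: rpredB.
    by apply: dvdz_trans (cg N); rewrite dvdzE dvdn_gcdr.
  by apply: dvdz_trans (lift_le B_gt0 HS g kN); rewrite dvdzE dvdn_gcdl.
apply/period_groupP => h; rewrite !(interior_windowP B_gt0 HS).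
suff MM k : M k (lift k (h + g)) <-> M k (lift k h).
  by split=> -[k nM]; exists k; move: nM; rewrite MM.
(* [lift k] is additive modulo s_k, hence modulo c_k, as c_k divides d_k and d_k divides s_k. *)
have kP : (c k %| lift k (h + g) - lift k h)%Z.
  rewrite -[_ - _](subrK (lift k g)); apply: rpredD.
    rewrite -addrA -opprD; apply: dvdz_trans (liftD B_gt0 HS k h g).
    by rewrite dvdzE (dvdn_trans (c_dvd_d k)) // (d_dvd_s B_gt0 HS).
  by apply: dvdz_trans (dg k); rewrite dvdzE c_dvd_d.
by have := is_period_dvdz (cP k) kP (lift k h); rewrite subrKC.
Qed.

End PeriodsOfTheWindow.

(** * Chinese remainders and lifts of units *)

(** Bezout solution of x = a mod m and x = b mod n: the first congruence always holds, the second
    when gcd(m, n) divides b - a. *)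
Definition crt (m n : nat) (a b : int) : int :=
  a + (egcdz m n).1 * m%:Z * ((b - a) %/ gcdz m n)%Z.

Lemma egcdzE (m n : int) : (egcdz m n).1 * m + (egcdz m n).2 * n = gcdz m n.
Proof. by case: egcdzP. Qed.

Lemma crt_eqmodl m n a b : (m %| crt m n a b - a)%Z.
Proof. by rewrite /crt addrAC subrr add0r -mulrA mulrCA dvdz_mulr. Qed.

Lemma crt_eqmodr m n a b : (gcdn m n %| b - a)%Z -> (n %| crt m n a b - b)%Z.
Proof.
move=> ab; rewrite /crt.
have -> : (egcdz m n).1 * m%:Z = gcdz m n - (egcdz m n).2 * n%:Z.
  by rewrite -egcdzE addrK.
have := divzK ab; rewrite -[(gcdn m n)%:Z]/(gcdz m n) => abK.
rewrite mulrBl [gcdz m n * _]mulrC abK addrA subrKC addrAC subrr add0r.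
by rewrite rpredN mulrAC dvdz_mull.
Qed.

(** When m divides M, this lifts a unit modulo m to a unit modulo M. *)
Lemma coprime_translate (a m : int) (M : nat) : (0 < M)%N -> coprimez a m ->
  exists t : int, coprimez (a + t * m) M.
Proof.
(* For a = 0 the choice of [t] below would be M, as [\pi(0)] is empty; but then m is 1 or -1 and t =
   1 works. *)
move=> M_gt0 am; have [a0|a0] := eqVneq a 0.
  move: am; rewrite a0 /coprimez gcd0z => /eqP[m1]; exists 1.
  by rewrite add0r mul1r gcdzC /gcdz m1 gcdn1.
(* [t] is divisible by exactly the primes of [M] that do not divide [a]. *)
pose D : nat_pred := (\pi(`|a|)^')%N; pose t := (M`_D)%N; exists t%:Z.
rewrite coprimezE /= /coprime.
set g := gcdn _ _.
have g_gt0 : (0 < g)%N by rewrite gcdn_gt0 M_gt0 orbT.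
have a_gt0 : (0 < `|a|)%N by rewrite absz_gt0.
rewrite eqn_leq g_gt0 andbT leqNgt; apply/negP => /pdiv_prime.
set p := pdiv g => pp.
have pg : (p %| g)%N by exact: pdiv_dvd.
have pM : (p %| M)%N by rewrite (dvdn_trans pg) ?dvdn_gcdr.
have pt : (p %| a + t%:Z * m)%Z by rewrite dvdzE (dvdn_trans pg) ?dvdn_gcdl.
have [pa|pa] := boolP (p %| a)%Z.
  have : (p %| t%:Z * m)%Z by move: pt; rewrite rpredDl.
  rewrite dvdzE abszM Euclid_dvdM // => /orP[pt'|pm].
    have := elimT (pnatP _ (part_gt0 _ M)) (part_pnat D M) p pp pt'.
    by rewrite inE /= /D inE mem_primes pp a_gt0 /= (_ : (p %| `|a|)%N).
  move: am; rewrite coprimezE /= => /(coprime_dvdl pa) /(coprime_dvdr pm).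
  by rewrite /coprime gcdnn /= => /eqP p1; move: pp; rewrite p1.
have pt' : (p %| t)%N.
  have := pM; rewrite -{1}(partnC D M_gt0) Euclid_dvdM // => /orP[//|pt'].
  have := elimT (pnatP _ (part_gt0 _ M)) (part_pnat D^'%N M) p pp pt'.
  rewrite inE /= /D inE /= negbK mem_primes pp a_gt0 /= => pa'.
  by move: pa; rewrite dvdzE /= pa'.
by case/negP: pa; move: pt; rewrite rpredDr // dvdz_mulr.
Qed.

(* With [x = 0 mod d'] and [x = g mod s], [x / d'] is a unit modulo [s / d]; shifting
   it by a multiple of [s / d] makes it a unit modulo [s' / d']. *)
Lemma generator_step (s s' d d' : nat) (g : int) : (0 < s')%N -> (s %| s')%N ->
  (d' %| s')%N -> gcdn s d' = d -> gcdz g s = d ->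
  exists g', (s %| g' - g)%Z /\ gcdz g' s' = d'.
Proof.
move=> s'0 ss' d's' sd' gs.
have s0 := dvdn_gt0 s'0 ss'; have d'0 := dvdn_gt0 s'0 d's'.
have d0 : (0 < d)%N by rewrite -sd' gcdn_gt0 s0.
have ds : (d %| s)%N by rewrite -sd' dvdn_gcdl.
have dd' : (d %| d')%N by rewrite -sd' dvdn_gcdr.
pose x := crt s d' g 0.
have sx : (s %| x - g)%Z := crt_eqmodl _ _ _ _.
have : (d' %| x)%Z.
  rewrite -[x]subr0; apply: crt_eqmodr; rewrite sd' sub0r rpredN -gs.
  exact: dvdz_gcdl.
move=> /dvdzP[a xE].
have sE : s%:Z = (s %/ d)%N%:Z * d%:Z by rewrite -PoszM divnK.
have am : coprimez a (s %/ d)%N.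
  (* The product gcd(a, s/d) d divides x and s, hence g; so it divides gcd(g, s) = d, and its first
     factor is 1. *)
  have : (gcdz a (s %/ d)%N * d %| d%:Z)%Z.
    rewrite -[X in (_ %| X)%Z]gs dvdz_gcd; apply/andP; split.
      rewrite -[g](subKr x); apply: rpredB.
        rewrite xE; apply: dvdz_mul; first exact: dvdz_gcdl.
        by rewrite dvdzE.
      apply: dvdz_trans sx.
      by rewrite sE dvdz_mul ?dvdz_gcdr.
    by rewrite sE dvdz_mul ?dvdz_gcdr.
  rewrite -[X in (_ %| X)%Z]mul1r dvdz_mul2r ?eqz_nat -?lt0n // dvdz1 //.
have M0 : (0 < s' %/ d')%N by rewrite divn_gt0 // dvdn_leq.
have [t at1] := coprime_translate M0 am.
exists ((a + t * (s %/ d)%N) * d'); split.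
  rewrite mulrDl -xE addrAC rpredD //.
  by rewrite -mulrA dvdz_mull // sE dvdz_mul.
rewrite -(divnK d's') PoszM -mulz_gcdl.
by move/eqP: at1 => ->; rewrite mul1r.
Qed.

(** * The isomorphisms *)

(** The induced map has inverse [sec] followed by the quotient map, so a continuous section,
    additive or not, makes it a homeomorphism. *)
Lemma quotient_iso (G K : topologicalZmodType) (U : zmodClosed G)
    (F : {additive G -> K}) (sec : K -> G) :
  continuous F -> continuous sec -> cancel sec F ->
  (forall x, x \in U <-> F x = 0) -> topgrp_iso (quotient_group U) K.
Proof.
move=> cF csec secK UF.
pose p : G -> quotient_group U := \pi_(Quotient.quot U)%qT.
have pB x y : p (x - y) = p x - p y by rewrite /p; exact: pi_is_zmod_morphism.
have UP x y : reflect (p x = p y) (x - y \in U).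
  by rewrite Quotient.idealrBE; exact: (iffP eqP).
have pP x y : p x = p y <-> F x = F y.
  split=> [/UP/UF|Fxy]; first by rewrite raddfB => /subr0_eq.
  by apply/UP/UF; rewrite raddfB Fxy subrr.
pose f (q : quotient_group U) : K := F (repr q).
have fp x : f (p x) = F x by apply/pP; rewrite /p reprK.
have fB : zmod_morphism f.
  move=> x y; rewrite -[x]reprK -[y]reprK -/(p _) -/(p (repr y)) -pB !fp.
  exact: raddfB.
pose fM := GRing.isZmodMorphism.Build (quotient_group U) K f fB.
pose f' : {additive quotient_group U -> K} := HB.pack f fM.
have [||q|q|g [_ ?]] := @topgrp_iso_of_cancel _ _ f' (p \o sec); last by exists f', g.
- by apply: repr_comp_continuous => // x y /eqP/pP ->.
- move=> x; apply: continuous_comp; [exact: csec|exact: pi_continuous].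
- by rewrite /= -[RHS]reprK; apply/pP; rewrite secK.
- by rewrite /= fp secK.
Qed.

Section Proposition.
Variables (B : set nat) (S : nat -> {fset nat}).
Hypothesis B_gt0 : B `<=` [set b | (0 < b)%N].
Hypothesis HS : filtration B S.

Local Notation s := (s_seq S).
Local Notation d := (d_seq B S).
Local Notation sd := (sd_seq B S).
Local Notation lift := (@int_lift B S).
Local Notation cyl := (@cylinder B S).
Local Notation s_chain := (s_chain B_gt0 HS).
Local Notation d_chain := (d_chain B_gt0 HS).
Local Notation sd_chain := (sd_chain B_gt0 HS).
Local Notation s_gt0 := (s_gt0 B_gt0 HS).
Local Notation d_gt0 := (d_gt0 B_gt0 HS).
Local Notation cylinder_congr := (cylinder_congr B_gt0 HS).
Implicit Types (h g : Hgroup B) (n : nat -> int).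

Lemma lift_congr k x h : cyl k x h -> (s k %| lift k h - x)%Z.
Proof. by move=> hx; exact: (cylinder_congr _ hx).1 (@liftP B S k h). Qed.

Lemma Hgroup_ext h g : (forall k, (s k %| lift k h - lift k g)%Z) -> h = g.
Proof.
move=> hg; apply/val_inj/functional_extensionality_dep => b.
have [k bk] := filtration_mem HS b.
rewrite (liftP g bk); apply: (_ : cyl k (lift k g) h) bk.
by apply: (cylinder_congr _ (@liftP B S k h)).2; rewrite -opprB rpredN.
Qed.

Lemma lift_compatible h : compatible s (lift ^~ h).
Proof. move=> k; exact: lift_le (leqnSn k). Qed.

(** * Points of [H] from compatible integers *)

Section Gluing.
Variables (n : nat -> int) (cn : compatible s n).

Definition glued : Zprod (fun b : B => \val b) :=
  fun b => residue (\val b) (n (projT1 (cid (filtration_mem HS b)))).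

Lemma gluedE k (b : B) : \val b \in S k -> glued b = residue (\val b) (n k).
Proof.
move=> bk; rewrite /glued; case: cid => j /= bj.
have sub i i' : (i <= i')%N -> \val b \in S i ->
    residue (\val b) (n i') = residue (\val b) (n i).
  move=> ii' bi; apply/residue_eqP; first exact: B_val_gt0.
  apply: dvdz_trans (compatible_le s_chain cn ii').
  by rewrite dvdzE dvdn_lcm_fset.
by case/orP: (leq_total j k) => /sub ->.
Qed.

(** [glued] is the limit of [Delta (n k)]: the coordinate at [b] is constant once [b] is in
    [S k]. *)
Lemma glued_mem : glued \in @H_pred B.
Proof.
apply/mem_set; apply: (@closed_cvg _ _ eventually _ (fun k => Delta (B:=B) (n k))
  (closure (range (@Delta B)))).
- exact: closed_closure.
- by apply: nearW => k; apply: subset_closure; exists (n k).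
apply: Zprod_cvg => b; apply/discrete_cvg.
have [k bk] := filtration_mem HS b.
exists k => // j /= kj; rewrite (@gluedE j) //.
exact: (fsubsetP (filtration_le HS kj)).
Qed.

Definition glueH : Hgroup B := exist _ glued glued_mem.

Lemma glueH_cylinder k : cyl k (n k) glueH.
Proof. by move=> b; exact: gluedE. Qed.

Lemma lift_glueH k : (s k %| lift k glueH - n k)%Z.
Proof. exact/lift_congr/glueH_cylinder. Qed.

End Gluing.

Lemma near_lift k h : \forall g \near h, (s k %| lift k g - lift k h)%Z.
Proof.
by apply: filterS (cylinder_nbhs (@liftP B S k h)) => g; exact: lift_congr.
Qed.

Lemma continuous_Hgroup (X : topologicalType) (f : X -> Hgroup B) :
  (forall k x, \forall y \near x, (s k %| lift k (f y) - lift k (f x))%Z) ->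
  continuous f.
Proof.
move=> cf x U /(nbhs_cylinder HS)[k kU]; apply: filterS (cf k x) => y xy.
apply: kU; apply: (cylinder_congr _ (@liftP B S k (f y))).2.
by rewrite -opprB rpredN.
Qed.

(** * [H] as the limit of Z/s_k *)

Definition H_to_lim h : invlim s_chain := invlim_of s_chain (lift_compatible h).

Lemma H_to_lim_is_zmod_morphism : zmod_morphism H_to_lim.
Proof.
apply: zmod_morphism_of_add => h g; apply: invlim_ext => k.
rewrite -[RHS]/(residue (s k) (lift k h) + residue (s k) (lift k g)) -raddfD.
by apply/residue_eqP; [exact: s_gt0|exact: liftD].
Qed.

HB.instance Definition _ := GRing.isZmodMorphism.Build (Hgroup B) (invlim s_chain)
  H_to_lim H_to_lim_is_zmod_morphism.

Lemma H_to_lim_continuous : continuous H_to_lim.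
Proof.
apply: continuous_invlim => k h; apply: filterS (near_lift k h) => g gh.
by apply/residue_eqP; first exact: s_gt0.
Qed.

Definition lim_to_H (x : invlim s_chain) : Hgroup B := glueH (rep_compatible x).

Lemma lim_to_H_cylinder (x : invlim s_chain) k : cyl k (rep (val x k)) (lim_to_H x).
Proof. exact: (glueH_cylinder (rep_compatible x)). Qed.

Lemma H_to_limK : cancel H_to_lim lim_to_H.
Proof.
move=> h; apply: Hgroup_ext => k.
rewrite -(subrKA (rep (val (H_to_lim h) k))); apply: rpredD; first exact: lift_glueH.
exact: dvdz_rep_residue (s_gt0 k).
Qed.

Lemma lim_to_HK : cancel lim_to_H H_to_lim.
Proof.
move=> x; apply: invlim_ext => k; rewrite -[RHS]residue_rep.
by apply/residue_eqP; [exact: s_gt0|exact: lift_glueH].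
Qed.

Lemma glueH_congr n n' (cn : compatible s n) (cn' : compatible s n') k :
  (s k %| n k - n' k)%Z -> (s k %| lift k (glueH cn) - lift k (glueH cn'))%Z.
Proof.
move=> nn'; rewrite -(subrKA (n k)); apply: rpredD; first exact: lift_glueH.
rewrite -(subrKA (n' k)); apply: rpredD => //.
by rewrite -opprB rpredN lift_glueH.
Qed.

Lemma lim_to_H_continuous : continuous lim_to_H.
Proof.
apply: continuous_Hgroup => k x; apply: filterS (near_invlim k x) => y yx.
by apply: glueH_congr; rewrite yx subrr dvdz0.
Qed.

Local Notation pr := (invlim_map s_chain d_chain (d_dvd_s B_gt0 HS)).

Lemma pr_H_to_lim h k : val (pr (H_to_lim h)) k = residue (d k) (lift k h).
Proof. by rewrite /= residue_proj ?s_gt0 ?(d_dvd_s B_gt0 HS). Qed.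

Lemma pr_continuous : continuous pr.
Proof.
apply: continuous_invlim => k x; apply: filterS (near_invlim k x) => y yx /=.
by rewrite yx.
Qed.

Lemma pr_eq0 h : h \in H_int_W B <-> pr (H_to_lim h) = 0.
Proof.
rewrite (H_int_WP B_gt0 HS); split=> [dh|h0 k].
  by apply: invlim_ext => k; rewrite pr_H_to_lim; apply/residue0P; first exact: d_gt0.
by apply/residue0P; rewrite ?d_gt0 // -pr_H_to_lim h0.
Qed.

(** * A continuous section over the limit of Z/d_k *)

Section SectionOfProjection.

(** Level [k] keeps the class modulo s_{k-1} and imposes y_k modulo d_k. It uses only y_0, ..., y_k,
    whence [sec_continuous]. *)
Fixpoint crt_lift (y : nat -> int) (k : nat) : int :=
  if k is k'.+1 then crt (s k') (d k) (crt_lift y k') (y k) else y 0%N.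

(** Inductively, the lift at level k is y_k, hence y_{k+1}, modulo d_k = gcd(s_k, d_{k+1}), so the
    next two congruences are solvable. *)
Lemma crt_lift_d y k : compatible d y -> (d k %| crt_lift y k - y k)%Z.
Proof.
move=> cy; elim: k => [|k IH] /=; first by rewrite subrr dvdz0.
apply: crt_eqmodr; rewrite (gcdn_s_d B_gt0 HS) //.
rewrite -(subrKA (y k)); apply: rpredD; first exact: cy.
by rewrite -opprB rpredN.
Qed.

Lemma crt_lift_compatible y : compatible s (crt_lift y).
Proof. by move=> k; exact: crt_eqmodl. Qed.

Definition sec (y : invlim d_chain) : Hgroup B :=
  glueH (crt_lift_compatible (fun k => rep (val y k))).

Lemma secK : cancel sec (fun h => pr (H_to_lim h)).
Proof.
move=> y; apply: invlim_ext => k; rewrite pr_H_to_lim -[RHS]residue_rep.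
apply/residue_eqP; first exact: d_gt0.
rewrite -(subrKA (crt_lift (fun k => rep (val y k)) k)); apply: rpredD.
  by apply: dvdz_trans (lift_glueH _ k); rewrite dvdzE d_dvd_s.
by apply: crt_lift_d; exact: rep_compatible.
Qed.

Lemma sec_continuous : continuous sec.
Proof.
apply: continuous_Hgroup => k y.
have : \forall z \near y, crt_lift (fun k => rep (val z k)) k =
                          crt_lift (fun k => rep (val y k)) k.
  elim: k => [|k IH] /=; first by apply: filterS (near_invlim 0%N y) => z ->.
  by apply: filterS2 IH (near_invlim k.+1 y) => z -> ->.
by apply: filterS => z zy; apply: glueH_congr; rewrite zy subrr dvdz0.
Qed.

End SectionOfProjection.

Lemma quotient_iso_lim : topgrp_iso (quotient_group (H_int_W B)) (invlim d_chain).
Proof.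
apply: (@quotient_iso _ _ _ (pr \o H_to_lim) sec).
- by move=> h; apply: continuous_comp; [exact: H_to_lim_continuous|exact: pr_continuous].
- exact: sec_continuous.
- exact: secK.
- exact: pr_eq0.
Qed.

(** * The kernel, divided by a topological generator *)

Section Generator.

Lemma generator_exists : exists g : nat -> int,
  compatible s g /\ forall k, gcdz (g k) (s k) = d k.
Proof.
(* Starting from d_0, the condition gcd(x, s_k) = d_k persists, so [generator_step] always applies
   and the default 0 is not reached. *)
pose next k x := xget 0 [set x' | (s k %| x' - x)%Z /\ gcdz x' (s k.+1) = d k.+1].
pose fix g k : int := if k is k'.+1 then next k' (g k') else d 0%N.
have nextP k x : gcdz x (s k) = d k ->
    (s k %| next k x - x)%Z /\ gcdz (next k x) (s k.+1) = d k.+1.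
  move=> xk; rewrite /next; case: xgetP => [x' _ //|none].
  have [|||||x' /none []] := @generator_step (s k) (s k.+1) (d k) (d k.+1) x.
  - exact: s_gt0.
  - exact: s_dvd HS k.
  - exact: d_dvd_s.
  - exact: gcdn_s_d (leqnSn k).
  - exact: xk.
have gE k : gcdz (g k) (s k) = d k.
  elim: k => [|k /nextP[]//].
  by rewrite /gcdz /= (gcdn_idPl (d_dvd_s B_gt0 HS 0)).
by exists g; split=> // k; exact: (nextP k _ (gE k)).1.
Qed.

Variables (g : nat -> int) (cg : compatible s g) (gE : forall k, gcdz (g k) (s k) = d k).

(** g_k is d_k times a unit modulo s_k/d_k, so multiplication by g_k embeds Z/(s_k/d_k) in Z/s_k. *)
Lemma generator_dvd k (z : int) : (s k %| z * g k)%Z <-> (sd k %| z)%Z.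
Proof.
have d0 : (d k)%:Z != 0 by rewrite eqz_nat -lt0n d_gt0.
have sE : (s k)%:Z = (sd k)%:Z * (d k)%:Z by rewrite -PoszM divnK ?d_dvd_s.
have /dvdzP[q qE] : (d k %| g k)%Z by rewrite -gE dvdz_gcdl.
split=> [zg|sz]; last first.
  by rewrite qE sE mulrA dvdz_mul // dvdz_mulr.
have := egcdzE (g k) (s k); rewrite gE => uv.
rewrite -(dvdz_mul2r d0) -sE -uv mulrDr mulrCA; apply: rpredD.
  exact: dvdz_mull.
by rewrite mulrA dvdz_mull.
Qed.

(* [(egcdz (g k) (s k)).1] inverts [g k / d k] modulo [s k / d k]. *)
Definition gen_coef k (x : int) : int := (egcdz (g k) (s k)).1 * (x %/ d k)%Z.

Lemma gen_coefP k x : (d k %| x)%Z -> (s k %| gen_coef k x * g k - x)%Z.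
Proof.
move=> dx; rewrite /gen_coef -{2}(divzK dx) mulrAC.
have -> : (egcdz (g k) (s k)).1 * g k = (d k)%:Z - (egcdz (g k) (s k)).2 * s k.
  by rewrite -gE -egcdzE addrK.
by rewrite mulrBl [_ * (d k)%:Z]mulrC addrAC subrr sub0r rpredN mulrAC dvdz_mull.
Qed.

(** Uniqueness of coefficients modulo s_k/d_k, by comparing after multiplication by g_k.
    Compatibility, additivity and continuity of [K_to_lim] rest on it. *)
Lemma gen_coef_congr k (x a : int) : (d k %| x)%Z -> (s k %| a * g k - x)%Z ->
  (sd k %| gen_coef k x - a)%Z.
Proof.
move=> dx ax; apply/generator_dvd; rewrite mulrBl -(subrKA x); apply: rpredD.
  exact: gen_coefP.
by rewrite -opprB rpredN.
Qed.

Local Notation K := (subgroup (H_int_W B)).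

Lemma lift_K (x : K) k : (d k %| lift k (val x))%Z.
Proof. exact: (H_int_WP B_gt0 HS (val x)).1 (valP x) k. Qed.

Definition coefs (x : K) k := gen_coef k (lift k (val x)).

Lemma coefs_compatible x : compatible sd (coefs x).
Proof.
move=> k; rewrite -opprB rpredN; apply: gen_coef_congr; first exact: lift_K.
have skS : (s k %| (s k.+1)%:Z)%Z by rewrite dvdzE (s_dvd HS).
(* As s_k divides g_{k+1} - g_k, the coefficient of level k + 1 also represents level k. *)
have -> : coefs x k.+1 * g k - lift k (val x) =
    (coefs x k.+1 * g k.+1 - lift k.+1 (val x)) +
    (lift k.+1 (val x) - lift k (val x)) - coefs x k.+1 * (g k.+1 - g k).
  by rewrite subrKA mulrBr opprB [RHS]addrC subrKA.
apply: rpredB; last by rewrite dvdz_mull.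
apply: rpredD; last exact: lift_compatible.
by apply: dvdz_trans skS _; apply: gen_coefP; exact: lift_K.
Qed.

Definition K_to_lim x : invlim sd_chain := invlim_of sd_chain (coefs_compatible x).

Lemma K_to_lim_is_zmod_morphism : zmod_morphism K_to_lim.
Proof.
apply: zmod_morphism_of_add => x y; apply: invlim_ext => k.
rewrite -[RHS]/(residue (sd k) (coefs x k) + residue (sd k) (coefs y k)) -raddfD.
apply/residue_eqP; first exact: (sd_chain k).1.
apply: gen_coef_congr; first exact: lift_K.
rewrite -(subrKA (lift k (val x) + lift k (val y))); apply: rpredD; last first.
  by rewrite -opprB rpredN; exact: liftD.
by rewrite mulrDl opprD addrACA; apply: rpredD; apply: gen_coefP; exact: lift_K.
Qed.

HB.instance Definition _ := GRing.isZmodMorphism.Build K (invlim sd_chain)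
  K_to_lim K_to_lim_is_zmod_morphism.

Lemma multiples_compatible (y : invlim sd_chain) :
  compatible s (fun k => rep (val y k) * g k).
Proof.
move=> k.
have -> : rep (val y k.+1) * g k.+1 - rep (val y k) * g k =
  rep (val y k.+1) * (g k.+1 - g k) + (rep (val y k.+1) - rep (val y k)) * g k.
  by rewrite mulrBr mulrBl subrKA.
apply: rpredD; first by rewrite dvdz_mull.
by apply/generator_dvd; exact: rep_compatible.
Qed.

Lemma lim_to_K_mem (y : invlim sd_chain) : glueH (multiples_compatible y) \in H_int_W B.
Proof.
apply/(H_int_WP B_gt0 HS) => k.
rewrite -(subrK (rep (val y k) * g k) (lift k _)); apply: rpredD.
  by apply: dvdz_trans (lift_glueH _ k); rewrite dvdzE d_dvd_s.
by rewrite dvdz_mull // -gE dvdz_gcdl.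
Qed.

Definition lim_to_K (y : invlim sd_chain) : K :=
  exist _ (glueH (multiples_compatible y)) (lim_to_K_mem y).

Lemma kernel_iso_lim : topgrp_iso K (invlim sd_chain).
Proof.
have [||x|y|f [_ ?]] := @topgrp_iso_of_cancel _ _ K_to_lim lim_to_K; last by exists K_to_lim, f.
- apply: continuous_invlim => k x.
  have : \forall y \near x, (s k %| lift k (val y) - lift k (val x))%Z.
    exact: (subgroup_val_continuous (near_lift k (val x))).
  apply: filterS => y yx; apply/residue_eqP; first exact: (sd_chain k).1.
  apply: gen_coef_congr; first exact: lift_K.
  rewrite -(subrKA (lift k (val x))); apply: rpredD.
    by apply: gen_coefP; exact: lift_K.
  by rewrite -opprB rpredN.
- apply: continuous_comp_initial; apply: continuous_Hgroup => k y.
  apply: filterS (near_invlim k y) => z zy.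
  by apply: glueH_congr; rewrite zy subrr dvdz0.
- apply/val_inj; apply: Hgroup_ext => k.
  rewrite -(subrKA (rep (val (K_to_lim x) k) * g k)); apply: rpredD.
    exact: lift_glueH.
  rewrite -(subrKA (coefs x k * g k)); apply: rpredD; last exact/gen_coefP/lift_K.
  rewrite -mulrBl; apply/generator_dvd; exact: dvdz_rep_residue (sd_chain k).1.
- apply: invlim_ext => k; rewrite -[RHS]residue_rep.
  apply/residue_eqP; first exact: (sd_chain k).1.
  apply: gen_coef_congr; first exact: lift_K.
  rewrite -opprB rpredN; exact: lift_glueH.
Qed.

Lemma kernel_trivial_iff : [set` H_int_W B] = [set 0] <-> forall k, s k = d k.
Proof.
split=> [K0 k|sd_eq]; last first.
  apply/seteqP; split=> [h /(H_int_WP B_gt0 HS) dh|_ ->]; last exact: rpred0.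
  apply: Hgroup_ext => k; apply: rpredB; rewrite sd_eq; first exact: dh.
  exact: (H_int_WP B_gt0 HS 0).1 (rpred0 _) k.
(* The generator lies in the kernel; if it is 0, then s_k divides g_k, so d_k = gcd(g_k, s_k) is
   s_k. *)
have : [set` H_int_W B] (glueH cg).
  apply/(H_int_WP B_gt0 HS) => j; rewrite -(subrK (g j) (lift j _)); apply: rpredD.
    by apply: dvdz_trans (lift_glueH _ j); rewrite dvdzE d_dvd_s.
  by rewrite -gE dvdz_gcdl.
rewrite K0 => g0.
have sg : (s k %| g k)%Z.
  rewrite -[g k](subKr (lift k (glueH cg))); apply: rpredB; last exact: lift_glueH.
  rewrite g0; have /lift_congr : cyl k 0 0 by move=> b _; rewrite raddf0.
  by rewrite subr0.
by apply/eqP; rewrite -eqz_nat -gE eq_sym; apply/eqP/gcdz_idPr.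
Qed.

End Generator.

Lemma s_eq_d_iff : (forall k, s k = d k) <->
  forall b, B b -> exists l, (b %| c_seq B S l)%N.
Proof.
split=> [sd_eq b|Bc k].
  rewrite -{1}HS.2 => -[k _ bk]; have [N /(_ N (leqnn N)) [_ dE]] := d_stable B_gt0 HS k.
  exists N; apply: dvdn_trans (dvdn_lcm_fset bk) _.
  by rewrite -/(s k) sd_eq dE dvdn_gcdr.
(* [S k] is finite and the c_l form a divisibility chain, so a single c_N is divisible by all of
   [S k], hence by s_k. *)
have [N hN] : exists N, forall b, b \in S k -> (b %| c_seq B S N)%N.
  have : forall b : nat, b \in S k -> \forall l \near \oo, (b %| c_seq B S l)%N.
    move=> b bk; have [|n bn] := Bc b; first by rewrite -HS.2; exists k.
    by exists n => // m /= nm; rewrite (dvdn_trans bn) ?(c_dvd_le B_gt0 HS).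
  move=> /filter_bigI[N _ hN]; exists N; exact: hN (leqnn N).
have [N' hN'] := d_stable B_gt0 HS k.
rewrite (hN' (maxn N N') (leq_maxr _ _)).2; apply/esym/gcdn_idPl.
have := lcm_fset_dvdz (T := S k) (z := c_seq B S (maxn N N')).
rewrite dvdzE; apply => b /hN bN; rewrite dvdzE (dvdn_trans bN) //.
by rewrite (c_dvd_le B_gt0 HS) ?leq_maxl.
Qed.

End Proposition.

Theorem proposition1p3 (B : set nat) (B_gt0 : B `<=` [set b | (0 < b)%N])
    (B_inf : infinite_set B) (S : nat -> {fset nat}) (HS : filtration B S) :
  [/\ exists (phi : {additive invlim (s_chain B_gt0 HS) -> Hgroup B})
             (psi : {additive Hgroup B -> invlim (s_chain B_gt0 HS)}),
        [/\ forall (n : nat -> int) (x : invlim (s_chain B_gt0 HS)),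
              (forall k, val x k = residue (s_seq S k) (n k)) ->
              forall k (b : B), \val b \in S k ->
                val (phi x) b = residue (\val b) (n k),
            is_topgrp_iso phi psi &
            short_exact (\val : {additive subgroup (H_int_W B) -> Hgroup B})
              (invlim_map (s_chain B_gt0 HS) (d_chain B_gt0 HS)
                 (d_dvd_s B_gt0 HS) \o psi)],
      topgrp_iso (subgroup (H_int_W B)) (invlim (sd_chain B_gt0 HS)),
      topgrp_iso (quotient_group (H_int_W B)) (invlim (d_chain B_gt0 HS)) &
      ([set` H_int_W B] = [set 0] <-> forall k, s_seq S k = d_seq B S k) /\
      ((forall k, s_seq S k = d_seq B S k) <->
       forall b, B b -> exists n, (b %| c_seq B S n)%N)].
Proof.
have [g [cg gE]] := generator_exists B_gt0 HS.
split.
- pose psi : {additive Hgroup B -> invlim (s_chain B_gt0 HS)} := @H_to_lim B S B_gt0 HS.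
  have [phi [phiE [cpsi cphi psiK phiK]]] := topgrp_iso_of_cancel (f := psi)
    (@H_to_lim_continuous B S B_gt0 HS) (@lim_to_H_continuous B S B_gt0 HS)
    (@H_to_limK B S B_gt0 HS) (@lim_to_HK B S B_gt0 HS).
  exists phi, psi; split=> //.
    (* The integers [rep (val x k)] and [n k] agree modulo s_k, so they define the same cylinder. *)
    move=> n x xn k b bk; rewrite phiE; apply: (_ : cylinder S k (n k) (lim_to_H x)) bk.
    apply: (cylinder_congr B_gt0 HS _ (@lim_to_H_cylinder _ _ _ _ x k)).2.
    by apply/residue_eqP; [exact: (s_gt0 B_gt0 HS)|rewrite residue_rep xn].
  split.
  + split; first exact: subgroup_val_continuous.
    by move=> h; apply: continuous_comp; [exact: cpsi|exact: pr_continuous].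
  + exact: val_inj.
  + apply/seteqP; split=> [_ [x _ <-]|h /pr_eq0 hK]; first exact/pr_eq0/valP.
    by exists (exist _ h hK).
  + by apply/seteqP; split=> // y _; exists (sec y) => //; exact: secK.
- exact: kernel_iso_lim cg gE.
- exact: quotient_iso_lim.
- split; [exact: kernel_trivial_iff cg gE|exact: s_eq_d_iff].
Qed.
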